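(* Let $\mathcal{H}$ be a Hilbert space, let $A,B\in\mathcal{B}(\mathcal{H})$ be self-adjoint operators with spectra contained in the interval $J$, and let $f\in C^1_{\mathrm{co}}(J)$. If $B\le A$ and $f$ is decreasing, then the number $$\gamma=\sup_{x\in\mathcal{H},\ \|x\|=1}\left\{\langle f'(B)Bx,x\rangle-\langle Ax,x\rangle\langle f'(B)x,x\rangle\right\}$$ is non-negative and satisfies $$f(B)\le f(A)+\gamma\,\mathbf{1}_{\mathcal{H}}.$$
   Context: $\mathcal{B}(\mathcal{H})$ is the $C^*$-algebra of bounded linear operators on a (complex) Hilbert space $\mathcal{H}$, with identity $\mathbf{1}_{\mathcal{H}}$. An operator $A$ is positive ($A\ge 0$) if $\langle Ax,x\rangle\ge 0$ for all $x\in\mathcal{H}$; for self-adjoint $A,B$, $A\le B$ means $B-A\ge 0$. $C^1_{\mathrm{co}}(J)$ denotes the class of differentiable convex real functions on the interval $J\subseteq\mathbb{R}$ (one-sided derivatives at endpoints belonging to $J$); $f'$ is the derivative of $f$. ''Decreasing'' means $f'\le 0$ on $J$. For a self-adjoint operator $T$ with spectrum in $J$, $f(T)$ and $f'(T)$ are defined by the continuous functional calculus. *)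

(* Defs.v *)
From HB Require Import structures.
From mathcomp Require Import all_boot all_order all_algebra.
From mathcomp Require Import complex sesquilinear.
From mathcomp Require Import all_classical all_reals all_analysis.

Set Implicit Arguments.
Unset Strict Implicit.
Unset Printing Implicit Defensive.

Import Order.TTheory GRing.Theory Num.Theory.
Import numFieldNormedType.Exports.

Local Open Scope classical_set_scope.
Local Open Scope ring_scope.
Local Open Scope complex_scope.

(* A complex Hilbert space is a complete normed module over R[i] together with
   an inner product [dot], linear in its first argument and conjugate-linear in
   the second, satisfying [norm_from_dot dot]. Recall that z <= w in R[i] means
   that w - z is real and nonnegative. *)
Definition norm_from_dot (R : realType) (H : completeNormedModType R[i])
    (dot : {dot H for (@Num.conj R[i])}) : Prop :=
  forall x : H, `|x| ^+ 2 = dot x x.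

Definition bounded_operator (R : realType) (H : completeNormedModType R[i])
    (T : H -> H) : Prop :=
  exists M : R, forall x : H, `|T x| <= M%:C * `|x|.

Definition self_adjoint (R : realType) (H : completeNormedModType R[i])
    (dot : {dot H for (@Num.conj R[i])}) (T : {linear H -> H}) : Prop :=
  forall x y : H, dot (T x) y = dot x (T y).

Definition positive_operator (R : realType) (H : completeNormedModType R[i])
    (dot : {dot H for (@Num.conj R[i])}) (T : H -> H) : Prop :=
  forall x : H, 0 <= dot (T x) x.

Definition operator_le (R : realType) (H : completeNormedModType R[i])
    (dot : {dot H for (@Num.conj R[i])}) (S T : H -> H) : Prop :=
  positive_operator dot (fun x => T x - S x).

Definition spectrum (R : realType) (H : completeNormedModType R[i])
    (T : {linear H -> H}) : set R[i] :=
  [set l | ~ exists S : {linear H -> H},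
     [/\ bounded_operator S,
         forall x, S (l *: x - T x) = x
       & forall x, l *: S x - T (S x) = x]].

Definition poly_operator (R : realType) (H : completeNormedModType R[i])
    (T : {linear H -> H}) (p : {poly R}) : H -> H :=
  fun x => \sum_(k < size p) (p`_k)%:C *: iter k T x.

(* Continuous functional calculus for a self-adjoint T, whose spectrum is real:
   f(T) is the limit in operator norm of p_n(T), for polynomials p_n converging
   to f uniformly on the spectrum of T. *)
Definition is_cfc (R : realType) (H : completeNormedModType R[i])
    (T : {linear H -> H}) (f : R -> R) (S : H -> H) : Prop :=
  exists p : nat -> {poly R},
    (forall e : R, 0 < e -> \forall n \near \oo,
       forall t : R, spectrum T t%:C -> `|(p n).[t] - f t| <= e) /\
    (forall e : R, 0 < e -> \forall n \near \oo,
       forall x : H, `|poly_operator T (p n) x - S x| <= e%:C * `|x|).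

(* The default value 0 is irrelevant when T is bounded self-adjoint and f is
   continuous on its spectrum: f(T) then exists and is unique. *)
Definition cfc (R : realType) (H : completeNormedModType R[i])
    (T : {linear H -> H}) (f : R -> R) : H -> H :=
  xget (fun=> 0) [set S | is_cfc T f S].

(* The difference quotient is restricted to J, so that the derivative is
   one-sided at the endpoints belonging to J. *)
Definition derivable_in (R : realType) (J : set R) (f : R -> R) (t : R) : Prop :=
  cvg ((f s - f t) / (s - t) @[s --> within J t^']).

Definition derive_in (R : realType) (J : set R) (f : R -> R) (t : R) : R :=
  lim ((f s - f t) / (s - t) @[s --> within J t^']).

Definition C1co (R : realType) (J : set R) (f : R -> R) : Prop :=
  convex_function (J : set R^o) f /\ (forall t, J t -> derivable_in J f t).

(* Main.v *)
Require Import Defs.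
From HB Require Import structures.
From mathcomp Require Import all_boot all_order all_algebra.
From mathcomp Require Import complex sesquilinear.
From mathcomp Require Import all_classical all_reals all_analysis.
From mathcomp Require Import ring lra.

Set Implicit Arguments.
Unset Strict Implicit.
Unset Printing Implicit Defensive.

Import Order.TTheory GRing.Theory Num.Theory.
Import numFieldNormedType.Exports.

Local Open Scope classical_set_scope.
Local Open Scope ring_scope.
Local Open Scope complex_scope.

(* Tangents of f give f(t) + f'(t)(s - t) <= f(s) for t in the spectrum of B and
   s = <Ax,x>, where |x| = 1; by the functional calculus of B,
     <f(B)x,x> <= f(<Ax,x>) + <f'(B)Bx,x> - <Ax,x><f'(B)x,x>,
   and f(<Ax,x>) <= <f(A)x,x> by the tangent of f at <Ax,x>. For gamma >= 0, use
   <Bx,x> <= <Ax,x>, f'(B) <= 0 and <f'(B)Bx,x> >= <Bx,x><f'(B)x,x>, the latter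
   because (t - m)(f'(t) - f'(m)) >= 0 with m = <Bx,x>.
   All of this rests on p(T) >= 0 for a polynomial p >= 0 on the spectrum of T:
   the infimum m of the numerical range of p(T) is a value of p on the spectrum,
   since otherwise p(T) - m, a product of boundedly invertible factors T - z,
   would be bounded below. *)

(** * Weierstrass approximation *)

(* The Bernstein polynomial of degree n of the node values h 0, ..., h n,
   computed by De Casteljau's recursion. *)
Fixpoint bernstein (R : realType) (n : nat) (h : nat -> R) : {poly R} :=
  if n is m.+1 then
    'X * bernstein m (h \o S) + (1 - 'X) * bernstein m h
  else (h 0%N)%:P.

Lemma bernstein_recE (R : realType) n (h : nat -> R) x :
  (bernstein n.+1 h).[x] =
  x * (bernstein n (h \o S)).[x] + (1 - x) * (bernstein n h).[x].
Proof. by rewrite /= !hornerE. Qed.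

(** On [0, 1] the recursion is a convex combination, so inequalities between node values
    propagate. *)
Lemma le_bernstein (R : realType) n (h k : nat -> R) x :
  0 <= x <= 1 -> (forall i, (i <= n)%N -> h i <= k i) ->
  (bernstein n h).[x] <= (bernstein n k).[x].
Proof.
move=> /andP[x0 x1]; elim: n h k => [|n IH] h k hk.
  by rewrite /= !hornerE hk.
rewrite !bernstein_recE lerD// ler_wpM2l ?subr_ge0// IH// => i ni.
  exact: hk.
by rewrite hk// ltnW.
Qed.

(* For y = n x this is the variance n x (1 - x) of the binomial distribution. *)
Lemma bernstein_sqr (R : realType) n (c0 c1 y x : R) :
  (bernstein n (fun i => c0 + c1 * (i%:R - y) ^+ 2)).[x] =
  c0 + c1 * (n%:R * x * (1 - x) + (n%:R * x - y) ^+ 2).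
Proof.
elim: n y => [|n IH] y; first by rewrite /= !hornerE.
rewrite bernstein_recE IH.
have -> : (fun i => c0 + c1 * (i%:R - y) ^+ 2) \o S =
          fun i => c0 + c1 * (i%:R - (y - 1)) ^+ 2.
  by apply/funext => i /=; rewrite -natr1; ring.
by rewrite IH -natr1; ring.
Qed.

(** Heine-Cantor: compactness of [a, b] turns a [d] that works near each point into one that works
    everywhere. *)
Lemma uniform_continuity_itv (R : realType) (a b : R) (g : R -> R) :
  {within `[a, b], continuous g} ->
  forall e : R, 0 < e -> exists2 d : R, 0 < d &
    forall s t, s \in `[a, b] -> t \in `[a, b] -> `|s - t| < d ->
      `|g s - g t| < e.
Proof.
move=> gc e e0.
pose P d s := s \in `[a, b] -> forall t, t \in `[a, b] ->
  `|s - t| < d -> `|g s - g t| < e.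
have [] : \forall d \near (0 : R)^'+, `[a, b]%classic `<=` P d.
  have /compact_near_coveringP := @segment_compact R a b.
  apply=> x xab.
  have /subspace_continuousP/(_ x xab) := gc.
  move=> /cvgrPdist_lt/(_ (e / 2)).
  rewrite divr_gt0// => /(_ isT).
  rewrite near_withinE => -[r /= r0 hr].
  (* If s is within r / 2 of x and t within r / 2 of s, both are within r of x, where g differs from
     g(x) by less than e / 2. *)
  exists (ball x (r / 2), [set d | 0 < d < r / 2]).
    split; first by apply: nbhsx_ballx; rewrite divr_gt0.
    exists (r / 2) => /=; first by rewrite divr_gt0.
    by move=> d /=; rewrite sub0r normrN => + d0; rewrite gtr0_norm ?d0.
  move=> [s d] [/= xs /andP[d0 dr] sab t tab std].
  have := hr s; have := hr t.
  rewrite /= => /(_ _ tab) ht /(_ _ sab) hs.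
  have xs' : `|x - s| < r / 2 by exact: xs.
  have := hs ltac:(lra); have := ht ltac:(by have := ler_distD s x t; lra).
  have := ler_distD (g x) (g s) (g t); rewrite (distrC (g s) (g x)); lra.
move=> r /= r0 /(_ (r / 2)) /=.
rewrite sub0r normrN gtr0_norm ?divr_gt0// => hr.
exists (r / 2); first by rewrite divr_gt0.
move=> s t sab tab std; apply: (hr _ _ s) => //; lra.
Qed.

(** Bernstein's proof: |g(s) - g(t)| <= e / 2 + C (s - t)^2 on [a, b]. By monotonicity in the node
    values this bound passes from the nodes s to the polynomial at t, with the square replaced by a
    variance of order 1 / n. *)
Lemma weierstrass (R : realType) (a b : R) (g : R -> R) :
  {within `[a, b], continuous g} -> forall e : R, 0 < e ->
  exists p : {poly R}, forall t, t \in `[a, b] -> `|p.[t] - g t| <= e.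
Proof.
move=> gc e e0; have [ba|ab] := leP b a.
  exists (g a)%:P => t; rewrite in_itv/= => /andP[at_ tb].
  by have -> : t = a; [lra|rewrite hornerE subrr normr0 ltW].
have [M M0 hM] : exists2 M : R, 0 <= M & forall t, t \in `[a, b] -> `|g t| <= M.
  have [|c cab hc] := @EVT_max R (fun t => `|g t|) a b (ltW ab).
    apply/subspace_continuousP => x xab.
    have /subspace_continuousP/(_ x xab) := gc.
    exact: cvg_norm.
  by exists `|g c|.
have [d d0 hd] := uniform_continuity_itv gc (divr_gt0 e0 (ltr0n _ 2)).
(* Chosen so that |s - t| >= d gives C (s - t)^2 >= 2 M >= |g(s) - g(t)|. *)
pose C := 2 * M / d ^+ 2.
have C0 : 0 <= C := divr_ge0 (mulr_ge0 (ler0n _ 2) M0) (sqr_ge0 d).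
have osc s t : s \in `[a, b] -> t \in `[a, b] ->
    `|g s - g t| <= e / 2 + C * (s - t) ^+ 2.
  move=> sab tab; have [std|dst] := ltP `|s - t| d.
    by apply: ler_wpDr (mulr_ge0 C0 (sqr_ge0 _)) _; apply: ltW; apply: hd.
  apply: ler_wpDl (ltW (divr_gt0 e0 (ltr0n _ 2))) _.
  apply: (@le_trans _ _ (2 * M)).
    by have := hM _ sab; have := hM _ tab; have := ler_normB (g s) (g t); lra.
  rewrite /C mulrAC ler_pdivlMr ?exprn_gt0// ler_wpM2l ?mulr_ge0//.
  by rewrite -(real_normK (num_real (s - t))) ler_sqr ?nnegrE// ltW.
have [n hn] : exists n : nat, 2 * C * (b - a) ^+ 2 / e < n.+1%:R.
  by exists (Num.truncn (2 * C * (b - a) ^+ 2 / e)); rewrite truncnS_gt.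
pose h i := g (a + (b - a) * (i%:R / n.+1%:R)).
(* The affine substitution carries [a, b] to [0, 1]. *)
exists (bernstein n.+1 h \Po ((b - a)^-1 *: ('X - a%:P))) => t tab.
have ba0 : 0 < b - a by rewrite subr_gt0.
rewrite horner_comp hornerZ hornerXsubC; set x := (_ * _).
have tE : t = a + (b - a) * x by rewrite /x; field; rewrite gt_eqF.
move: (tab); rewrite in_itv/= => /andP[at_ tb].
have x01 : 0 <= x <= 1.
  rewrite /x mulr_ge0 ?subr_ge0 ?invr_ge0 ?(ltW ba0)//=.
  by rewrite mulrC ler_pdivrMr// mul1r; lra.
have n0 : 0 < n.+1%:R :> R by [].
(* This is [C] rescaled to indices: c (i - (n + 1) x)^2 = C (s - t)^2 for the i-th node s. *)
pose c := C * (b - a) ^+ 2 / n.+1%:R ^+ 2.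
have c0 : 0 <= c := divr_ge0 (mulr_ge0 C0 (sqr_ge0 _)) (sqr_ge0 _).
have node i : (i <= n.+1)%N ->
    `|h i - g t| <= e / 2 + c * (i%:R - n.+1%:R * x) ^+ 2.
  move=> ni; rewrite /h; set s := (a + _).
  have sab : s \in `[a, b].
    have i0 : 0 <= i%:R / n.+1%:R :> R by rewrite divr_ge0.
    have i1 : i%:R / n.+1%:R <= 1 :> R.
      by rewrite ler_pdivrMr// mul1r ler_nat.
    rewrite in_itv/= /s; apply/andP; split.
      by rewrite lerDl mulr_ge0// ltW.
    by rewrite -lerBrDl ler_piMr// ltW.
  apply: le_trans (osc _ _ sab tab) _; rewrite lerD2l /c {1}tE /s.
  by rewrite le_eqVlt; apply/orP; left; apply/eqP; field; rewrite gt_eqF.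
have cvar : c * (n.+1%:R * x * (1 - x) + (n.+1%:R * x - n.+1%:R * x) ^+ 2)
    <= e / 2.
  rewrite subrr expr0n addr0.
  have -> : c * (n.+1%:R * x * (1 - x)) =
      C * (b - a) ^+ 2 / n.+1%:R * (x * (1 - x)).
    by rewrite /c; field; rewrite gt_eqF.
  have k0 : 0 <= C * (b - a) ^+ 2 / n.+1%:R.
    exact: divr_ge0 (mulr_ge0 C0 (sqr_ge0 _)) (ltW n0).
  have k1 : C * (b - a) ^+ 2 / n.+1%:R <= e / 2.
    by rewrite ler_pdivrMr//; move: hn; rewrite ltr_pdivrMr//; lra.
  have : x * (1 - x) <= 1 by nra.
  by move=> /(ler_wpM2l k0); rewrite mulr1 => /le_trans; apply.
have up := le_bernstein x01 (fun i ni => ler_distlDr (node i ni)).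
have lo := le_bernstein x01 (fun i ni => ler_distlCBl (node i ni)).
move: up lo.
(* Both bounds take the form of [bernstein_sqr] with y = (n + 1) x, where only the variance
   remains. *)
have -> : (fun i : nat => g t + (e / 2 + c * (i%:R - n.+1%:R * x) ^+ 2)) =
   fun i => (g t + e / 2) + c * (i%:R - n.+1%:R * x) ^+ 2.
  by apply/funext => i; rewrite addrA.
have -> : (fun i : nat => g t - (e / 2 + c * (i%:R - n.+1%:R * x) ^+ 2)) =
   fun i => (g t - e / 2) + (- c) * (i%:R - n.+1%:R * x) ^+ 2.
  by apply/funext => i; ring.
rewrite !bernstein_sqr ler_norml => up lo; apply/andP; split; lra.
Qed.

(** * Derivatives of differentiable convex functions *)

Lemma cvg_within_dist (R : realType) (J : set R) (g : R -> R) (t : R) :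
  (forall e : R, 0 < e -> exists2 d : R, 0 < d &
    forall s, J s -> `|s - t| < d -> `|g s - g t| <= e) ->
  g s @[s --> within J (nbhs t)] --> g t.
Proof.
move=> H; apply/cvgrPdist_le => e e0; have [d d0 hd] := H e e0.
rewrite near_withinE; exists d => //= s /=; rewrite distrC => st Js.
by rewrite distrC hd.
Qed.

Section C1co.
Variables (R : realType) (J : set R) (f : R -> R).
Hypotheses (itvJ : is_interval J) (fC1 : C1co J f).
Local Notation f' := (derive_in J f).

Lemma derive_in_dist t : J t -> forall e : R, 0 < e -> exists2 d : R, 0 < d &
  forall s, J s -> `|s - t| < d ->
    `|f s - f t - f' t * (s - t)| <= e * `|s - t|.
Proof.
move=> Jt e e0; have /cvgrPdist_le/(_ e e0) := fC1.2 _ Jt.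
rewrite !near_withinE => -[d /= d0 hd]; exists d => // s Js.
have [->|st] := eqVneq s t; first by rewrite !subrr mulr0 subrr normr0 mulr0.
move=> ds; have := hd s; rewrite /= distrC => /(_ ds st Js).
rewrite distrC => h; have st0 : s - t != 0 by rewrite subr_eq0.
by rewrite -ler_pdivrMr ?normr_gt0// -normf_div mulrBl mulfK.
Qed.

Lemma convex_segment x y l : J x -> J y -> 0 <= l <= 1 ->
  J (x + l * (y - x)) /\ f (x + l * (y - x)) <= f x + l * (f y - f x).
Proof.
move=> Jx Jy /andP[l0 l1]; split.
  by have [xy|/ltW yx] := leP x y; [apply: (itvJ Jx Jy)|apply: (itvJ Jy Jx)];
    apply/andP; split; nra.
(* [convex_function] takes its weight in a type of numbers in [0, 1], so [l] is repackaged. *)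
have l01 : Itv.spec (@Itv.num_sem R) (Itv.Real `[0%Z, 1%Z]) l.
  by rewrite /Itv.num_sem/= num_real/= in_itv/= l0 l1.
have fl : f (l * y + (1 - l) * x) <= l * f y + (1 - l) * f x :=
  fC1.1 (Itv.mk l01) y x (mem_set Jy) (mem_set Jx).
have -> : x + l * (y - x) = l * y + (1 - l) * x by ring.
by apply: le_trans fl _; lra.
Qed.

(** At u = t + l (s - t), the chord bounds f(u) from above and the expansion at t bounds it from
    below; dividing by l leaves an arbitrarily small error e. *)
Lemma tangent_le s t : J s -> J t -> f t + f' t * (s - t) <= f s.
Proof.
move=> Js Jt; have [->|st] := eqVneq s t; first by rewrite subrr mulr0 addr0.
have st0 : 0 < `|s - t| by rewrite normr_gt0 subr_eq0.
apply/ler_addgt0Pr => e e0.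
have [d d0 hd] := derive_in_dist Jt (divr_gt0 e0 st0).
(* l <= 1 keeps u on the segment, and l |s - t| < d makes the expansion at t valid. *)
pose l := Num.min 1 (d / 2 / `|s - t|).
have l0 : 0 < l by rewrite lt_min ltr01 !divr_gt0.
have l1 : l <= 1 by rewrite ge_min lexx.
have [|Ju fu] := @convex_segment t s l Jt Js; first by rewrite (ltW l0).
have := hd _ Ju; rewrite addrAC subrr add0r normrM (gtr0_norm l0).
have ld : l * `|s - t| < d.
  apply: (@le_lt_trans _ _ (d / 2)); last by lra.
  by rewrite -ler_pdivlMr// ge_min lexx orbT.
move=> /(_ ld); rewrite [e / _ * _]mulrCA divfK ?gt_eqF// ler_norml.
move=> /andP[hl _]; rewrite -(ler_pM2l l0); nra.
Qed.

Lemma derive_in_mono s t : J s -> J t -> 0 <= (f' s - f' t) * (s - t).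
Proof.
by move=> Js Jt; have := tangent_le Js Jt; have := tangent_le Jt Js; lra.
Qed.

(* If J has a point u beyond t on the side sg, then sg * f'(s) is at most the
   slope of the chord of f from s to u, times sg; otherwise f' being monotone is
   enough. *)
Lemma derive_in_semicontinuous (sg : R) t : sg = 1 \/ sg = -1 -> J t ->
  forall e : R, 0 < e -> exists2 d : R, 0 < d &
  forall s, J s -> `|s - t| < d -> sg * (f' s - f' t) <= e.
Proof.
move=> sgE Jt e e0.
have sg2 : sg * sg = 1 by case: sgE => ->; lra.
have [[r Jr rt]|nr] := pselect (exists2 r, J r & 0 < sg * (r - t)); last first.
  exists 1 => // s Js _; have := derive_in_mono Js Jt.
  have : sg * (s - t) <= 0.
    by rewrite leNgt; apply/negP => st; apply: nr; exists s.
  case: (ltgtP s t) => [st|ts|->]; last by move=> _ _; rewrite subrr mulr0 ltW.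
    by case: sgE => -> h1 h2; nra.
  by case: sgE => -> h1 h2; nra.
have [d d0 hd] := derive_in_dist Jt (divr_gt0 e0 (ltr0n _ 2)).
(* Small enough for u = t + sg h to lie in J and within [d] of t. *)
pose h := Num.min (sg * (r - t)) (d / 2).
have h0 : 0 < h by rewrite lt_min rt divr_gt0.
have hr : h <= sg * (r - t) by rewrite ge_min lexx.
have hd2 : h <= d / 2 by rewrite ge_min lexx orbT.
pose u := t + sg * h.
have nu : `|u - t| = h.
  rewrite /u addrAC subrr add0r normrM (gtr0_norm h0).
  by case: sgE => ->; rewrite ?normrN normr1 mul1r.
have Ju : J u.
  by case: sgE hr => E hr; rewrite /u E;
    [apply: (itvJ Jt Jr)|apply: (itvJ Jr Jt)];
    rewrite E in hr; apply/andP; split; lra.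
have hd_ : h < d by lra.
have := hd u Ju; rewrite nu => /(_ hd_); rewrite ler_norml => /andP[_ fu].
exists (h / 2) => [|s Js]; first by rewrite divr_gt0.
(* u - s = sg k, and |s - t| < h / 2 forces k > h / 2, so that an error (e / 2) h is at most e k. *)
move=> st; pose k := h - sg * (s - t).
have k0 : h / 2 < k.
  have : sg * (s - t) <= `|s - t|.
    by case: sgE => ->; rewrite ?mul1r ?mulN1r ?ler_norm// -normrN ler_norm.
  by rewrite /k; lra.
(* Combines the tangent at s taken at u, the tangent at t taken at s, and the expansion of f(u) at
   t. *)
have ak : sg * (f' s - f' t) * k <= e / 2 * h.
  have us : u - s = sg * k.
    have -> : sg * k = sg * h - sg * sg * (s - t) by rewrite /k; ring.
    by rewrite sg2 /u; ring.
  have ut : u - t = sg * k + (s - t) by rewrite -us; ring.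
  have := tangent_le Ju Js; have := tangent_le Js Jt; move: fu.
  rewrite us ut; lra.
rewrite -(ler_pM2r (_ : 0 < k)); last by lra.
by apply: le_trans ak _; nra.
Qed.

(** A differentiable convex function is automatically C^1: sg = 1 and sg = -1 bound f'(s) - f'(t)
    from above and below. This makes f'(B) available. *)
Lemma derive_in_continuous (I : set R) : I `<=` J ->
  {within I, continuous f'}.
Proof.
move=> IJ; apply/subspace_continuousP => t It.
apply: (cvg_within_dist (g := f')) => e e0.
have [d1 d10 h1] := derive_in_semicontinuous (or_introl erefl) (IJ _ It) e0.
have [d2 d20 h2] := derive_in_semicontinuous (or_intror erefl) (IJ _ It) e0.
exists (Num.min d1 d2) => [|s Is]; first by rewrite lt_min d10.
rewrite lt_min => /andP[s1 s2].
have := h1 s (IJ _ Is) s1; have := h2 s (IJ _ Is) s2.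
rewrite mulN1r mul1r ler_norml => h2s h1s; by apply/andP; split; lra.
Qed.

Lemma C1co_continuous (I : set R) : I `<=` J -> {within I, continuous f}.
Proof.
move=> IJ; apply/subspace_continuousP => t It.
apply: cvg_within_dist => e e0.
have [d d0 hd] := derive_in_dist (IJ _ It) (ltr01 : 0 < 1 :> R).
have k0 : 0 < 1 + `|f' t| by rewrite ltr_wpDr.
exists (Num.min d (e / (1 + `|f' t|))) => [|s Is].
  by rewrite lt_min d0 divr_gt0.
rewrite lt_min ltr_pdivlMr// => /andP[/(hd s (IJ _ Is)) + h].
have := ler_normD (f s - f t - f' t * (s - t)) (f' t * (s - t)).
by rewrite subrK normrM => *; nra.
Qed.

End C1co.

(** * Real norm and real inner product *)

Section RealNorm.
Variables (R : realType) (H : completeNormedModType R[i]).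

(** The norm of H has values in R[i]; its real part lets estimates take place in R. *)
Definition nrm (x : H) : R := complex.Re `|x|.

Lemma nrmE x : `|x| = (nrm x)%:C.
Proof.
have := normr_ge0 x; rewrite /nrm lecE /= => /andP[/eqP h _].
by case: `|x| h => a b /= ->.
Qed.

Lemma nrm_ge0 x : 0 <= nrm x.
Proof. by rewrite -ler0c -nrmE. Qed.

Lemma nrm_eq0 x : (nrm x == 0) = (x == 0).
Proof.
rewrite -[x == 0]normr_eq0 nrmE -(rmorph0 (real_complex R)).
by rewrite (inj_eq (@complexI R)).
Qed.

Lemma nrm0 : nrm 0 = 0.
Proof. by apply/eqP; rewrite nrm_eq0. Qed.

Lemma nrmZc (z : R[i]) x : nrm (z *: x) = complex.Re `|z| * nrm x.
Proof.
by apply: (@complexI R); rewrite -nrmE normrZ nrmE rmorphM; congr (_ * _).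
Qed.

Lemma nrmZ (r : R) x : nrm (r%:C *: x) = `|r| * nrm x.
Proof. by rewrite nrmZc normc_def /= expr0n addr0 sqrtr_sqr. Qed.

Lemma nrmN x : nrm (- x) = nrm x.
Proof. by rewrite /nrm normrN. Qed.

Lemma nrm_distC x y : nrm (x - y) = nrm (y - x).
Proof. by rewrite -nrmN opprB. Qed.

Lemma ler_nrmD x y : nrm (x + y) <= nrm x + nrm y.
Proof. by have := ler_normD x y; rewrite !nrmE -rmorphD lecR. Qed.

Lemma ler_nrm_dist z x y : nrm (x - y) <= nrm (x - z) + nrm (z - y).
Proof. by rewrite -[x - y](subrKA z) ler_nrmD. Qed.

Lemma nrm_unit x : x != 0 -> nrm ((nrm x)^-1%:C *: x) = 1.
Proof.
move=> x0; have nx : 0 < nrm x by rewrite lt_def nrm_eq0 x0 nrm_ge0.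
by rewrite nrmZ gtr0_norm ?invr_gt0// mulVf ?gt_eqF.
Qed.

Lemma bounded_operatorP (T : H -> H) : bounded_operator T ->
  exists2 K : R, 0 < K & forall x, nrm (T x) <= K * nrm x.
Proof.
move=> [M hM]; exists (`|M| + 1) => [|x]; first by rewrite ltr_wpDl.
have := hM x; rewrite !nrmE -rmorphM lecR => /le_trans; apply.
rewrite ler_wpM2r ?nrm_ge0//.
by apply: le_trans (ler_norm _) _; rewrite lerDl.
Qed.

(** Completeness with a rate: the tail bound [e] survives in the limit. *)
Lemma cauchy_limit (u : nat -> H) (e : nat -> R) :
  e @ \oo --> (0 : R) ->
  (forall m n, (m <= n)%N -> nrm (u n - u m) <= e m) ->
  exists l, forall n, nrm (u n - l) <= e n.
Proof.
move=> e0 ue; have ucvg : cvg (u @ \oo).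
  apply: cauchy_cvg; apply: cauchy_exP => d d0.
  have dE : d = (complex.Re d)%:C.
    by case: d d0 => a b; rewrite ltcE /= => /andP[/eqP -> _].
  have d0' : 0 < complex.Re d by move: d0; rewrite dE ltcR.
  move/cvgrPdist_lt : e0 => /(_ _ (divr_gt0 d0' (ltr0n _ 2))).
  move=> [N _ /(_ N (leqnn N))]; rewrite /= sub0r normrN => eN.
  have uN n : (N <= n)%N -> nrm (u n - u N) < complex.Re d / 2.
    by move=> /ue /le_lt_trans; apply; apply: le_lt_trans (ler_norm _) eN.
  exists (u N), N => // n /= Nn.
  rewrite -ball_normE /= dE nrmE ltcR nrm_distC.
  by apply: lt_le_trans (uN n Nn) _; lra.
exists (lim (u @ \oo)) => n; apply/ler_addgt0Pr => d d0.
have /cvgrPdist_lt/(_ d%:C) := ucvg; rewrite ltcR => /(_ d0)[N _ hN].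
have /= := hN (maxn N n) (leq_maxl _ _); rewrite nrmE ltcR => h.
have := ue n (maxn N n) (leq_maxr _ _).
have := ler_nrm_dist (u (maxn N n)) (u n) (lim (u @ \oo)).
by rewrite nrm_distC in h; rewrite [nrm (u n - u _)]nrm_distC; lra.
Qed.

End RealNorm.

Section InnerProduct.
Variables (R : realType) (H : completeNormedModType R[i]).
Variables (dot : {dot H for (@Num.conj R[i])}) (dotP : norm_from_dot dot).

(** A real inner product with the same norm; it carries the estimates, imaginary parts being treated
    apart. *)
Definition rdot (x y : H) : R := complex.Re (dot x y).

Lemma ReD (z w : R[i]) : complex.Re (z + w) = complex.Re z + complex.Re w.
Proof. by case: z; case: w. Qed.

Lemma ReZ (r : R) (z : R[i]) : complex.Re (r%:C * z) = r * complex.Re z.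
Proof. by case: z => a b /=; rewrite mul0r subr0. Qed.

Lemma dot_conj x y : dot x y = (dot y x)^*.
Proof. by rewrite hermC expr0 mul1r. Qed.

Lemma rdotC x y : rdot x y = rdot y x.
Proof. by rewrite /rdot dot_conj; case: (dot y x). Qed.

Lemma rdotDl x y z : rdot (x + y) z = rdot x z + rdot y z.
Proof. by rewrite /rdot linearDl ReD. Qed.

Lemma rdotZl r x y : rdot (r%:C *: x) y = r * rdot x y.
Proof. by rewrite /rdot linearZl_LR /= ReZ. Qed.

Lemma rdotNl x y : rdot (- x) y = - rdot x y.
Proof. by rewrite -scaleN1r -(rmorphN1 (real_complex R)) rdotZl mulN1r. Qed.

Lemma rdotBl x y z : rdot (x - y) z = rdot x z - rdot y z.
Proof. by rewrite rdotDl rdotNl. Qed.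

Lemma rdotDr x y z : rdot x (y + z) = rdot x y + rdot x z.
Proof. by rewrite rdotC rdotDl !(rdotC _ x). Qed.

Lemma rdotZr r x y : rdot x (r%:C *: y) = r * rdot x y.
Proof. by rewrite rdotC rdotZl rdotC. Qed.

Lemma rdotBr x y z : rdot x (y - z) = rdot x y - rdot x z.
Proof. by rewrite rdotC rdotBl !(rdotC _ x). Qed.

Lemma rdotxx x : rdot x x = nrm x ^+ 2.
Proof. by rewrite /rdot -dotP nrmE -rmorphXn. Qed.

(** Cauchy-Schwarz, by expanding the square norm of |y| x - |x| y. *)
Lemma rdot_le x y : rdot x y <= nrm x * nrm y.
Proof.
have [->|x0] := eqVneq x 0.
  by rewrite nrm0 mul0r -[X in rdot X](scale0r 0) rdotZl mul0r.
have [->|y0] := eqVneq y 0.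
  by rewrite nrm0 mulr0 rdotC -[X in rdot X](scale0r 0) rdotZl mul0r.
have nx : 0 < nrm x by rewrite lt_def nrm_eq0 x0 nrm_ge0.
have ny : 0 < nrm y by rewrite lt_def nrm_eq0 y0 nrm_ge0.
have : 0 <= rdot ((nrm y)%:C *: x - (nrm x)%:C *: y)
                 ((nrm y)%:C *: x - (nrm x)%:C *: y).
  by rewrite rdotxx sqr_ge0.
rewrite !(rdotBl, rdotBr, rdotZl, rdotZr) !rdotxx (rdotC y x) => h.
rewrite -(ler_pM2l (mulr_gt0 nx ny)); nra.
Qed.

Lemma rdot_norm x y : `|rdot x y| <= nrm x * nrm y.
Proof.
rewrite ler_norml rdot_le andbT lerNl -rdotNl.
by apply: le_trans (rdot_le _ _) _; rewrite nrmN.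
Qed.

(** Cauchy-Schwarz for ix and y, since Re <ix,y> = - Im <x,y>. *)
Lemma Im_dot_norm x y : `|complex.Im (dot x y)| <= nrm x * nrm y.
Proof.
have := rdot_norm ('i%C *: x) y.
rewrite nrmZc normc_def /= expr0n add0r expr1n sqrtr1 mul1r.
by rewrite /rdot linearZl_LR /= mulrC ReiNIm normrN.
Qed.

Lemma self_adjoint_rdot (T : {linear H -> H}) x y :
  self_adjoint dot T -> rdot (T x) y = rdot x (T y).
Proof. by move=> saT; rewrite /rdot saT. Qed.

Lemma self_adjoint_Im (T : {linear H -> H}) x :
  self_adjoint dot T -> complex.Im (dot (T x) x) = 0.
Proof.
move=> saT; have := dot_conj (T x) x; rewrite -saT.
by case: (dot _ _) => a b [] /=; lra.
Qed.

End InnerProduct.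

(** * Polynomials in an operator *)

Section PolyOperator.
Variables (R : realType) (H : completeNormedModType R[i]) (T : {linear H -> H}).
Implicit Types (q : {poly R[i]}) (p : {poly R}).

(** Complex coefficients are allowed here because the splitting into linear factors takes place over
    R[i]. *)
Definition cpoly_operator q (x : H) : H := \sum_(k < size q) q`_k *: iter k T x.

Lemma cpoly_operatorE n q x : (size q <= n)%N ->
  cpoly_operator q x = \sum_(k < n) q`_k *: iter k T x.
Proof.
move=> qn; rewrite /cpoly_operator.
rewrite (big_ord_widen n (fun k => q`_k *: iter k T x))//.
rewrite [RHS](bigID (fun k : 'I_n => (k < size q)%N)) /=.
rewrite [X in _ + X]big1 ?addr0// => k; rewrite -leqNgt => qk.
by rewrite nth_default// scale0r.
Qed.

Lemma cpoly_operatorC c x : cpoly_operator c%:P x = c *: x.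
Proof.
by rewrite (@cpoly_operatorE 1) ?size_polyC_leq1// big_ord1 coefC.
Qed.

Lemma cpoly_operatorD q1 q2 x :
  cpoly_operator (q1 + q2) x = cpoly_operator q1 x + cpoly_operator q2 x.
Proof.
pose n := maxn (size q1) (size q2).
rewrite !(@cpoly_operatorE n) ?leq_maxl ?leq_maxr ?size_polyD//.
by rewrite -big_split; apply: eq_bigr => k _; rewrite coefD scalerDl.
Qed.

Lemma cpoly_operatorMX q x : cpoly_operator (q * 'X) x = cpoly_operator q (T x).
Proof.
rewrite (@cpoly_operatorE (size q).+1); last first.
  by apply: leq_trans (size_polyMleq _ _) _; rewrite size_polyX addn2.
rewrite big_ord_recl coefMX eqxx scale0r add0r [RHS]/cpoly_operator.
by apply: eq_bigr => k _; rewrite coefMX /= -iterSr.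
Qed.

Lemma cpoly_operator_is_linear q : linear (cpoly_operator q).
Proof.
elim/poly_ind: q => [|q c IH] a x y.
  by rewrite -[0]/(0%:P) !cpoly_operatorC !scale0r scaler0 addr0.
rewrite !cpoly_operatorD !cpoly_operatorMX !cpoly_operatorC linearP IH.
by rewrite !scalerDr addrACA !scalerA mulrC.
Qed.

HB.instance Definition _ q :=
  GRing.isLinear.Build R[i] H H _ (cpoly_operator q)
    (cpoly_operator_is_linear q).

Lemma cpoly_operator_comm q x : cpoly_operator q (T x) = T (cpoly_operator q x).
Proof.
rewrite linear_sum; apply: eq_bigr => k _.
by rewrite linearZ -iterSr.
Qed.

Lemma cpoly_operatorM q1 q2 x :
  cpoly_operator (q1 * q2) x = cpoly_operator q1 (cpoly_operator q2 x).
Proof.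
elim/poly_ind: q1 q2 x => [|q c IH] q2 x.
  by rewrite mul0r -[0]/(0%:P) !cpoly_operatorC !scale0r.
rewrite mulrDl -mulrA -['X * q2]commr_polyX cpoly_operatorD IH cpoly_operatorMX.
rewrite cpoly_operatorD cpoly_operatorMX cpoly_operator_comm cpoly_operatorC.
congr (_ + _); rewrite mul_polyC.
rewrite (@cpoly_operatorE (size q2)) ?size_scale_leq// scaler_sumr.
by apply: eq_bigr => k _; rewrite coefZ scalerA.
Qed.

Lemma poly_operatorE p x :
  poly_operator T p x = cpoly_operator (map_poly (real_complex R) p) x.
Proof.
rewrite /cpoly_operator size_map_poly.
by apply: eq_bigr => k _; rewrite coef_map.
Qed.

Lemma poly_operator_is_linear p : linear (poly_operator T p).
Proof. by move=> a x y; rewrite !poly_operatorE linearP. Qed.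

HB.instance Definition _ p :=
  GRing.isLinear.Build R[i] H H _ (poly_operator T p)
    (poly_operator_is_linear p).

Lemma poly_operatorC c x : poly_operator T c%:P x = c%:C *: x.
Proof. by rewrite poly_operatorE map_polyC cpoly_operatorC. Qed.

Lemma poly_operatorD p1 p2 x :
  poly_operator T (p1 + p2) x = poly_operator T p1 x + poly_operator T p2 x.
Proof. by rewrite !poly_operatorE rmorphD cpoly_operatorD. Qed.

Lemma poly_operatorM p1 p2 x :
  poly_operator T (p1 * p2) x = poly_operator T p1 (poly_operator T p2 x).
Proof. by rewrite !poly_operatorE rmorphM cpoly_operatorM. Qed.

Lemma poly_operatorX x : poly_operator T 'X x = T x.
Proof.
rewrite poly_operatorE map_polyX -['X]mul1r cpoly_operatorMX.
by rewrite cpoly_operatorC scale1r.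
Qed.

Lemma poly_operatorN p x : poly_operator T (- p) x = - poly_operator T p x.
Proof.
rewrite -mulN1r -(rmorphN1 polyC) poly_operatorM poly_operatorC.
by rewrite rmorphN1 scaleN1r.
Qed.

Lemma poly_operatorB p1 p2 x :
  poly_operator T (p1 - p2) x = poly_operator T p1 x - poly_operator T p2 x.
Proof. by rewrite poly_operatorD poly_operatorN. Qed.

Lemma poly_operator_bounded p : bounded_operator T ->
  exists2 K : R, 0 < K & forall x, nrm (poly_operator T p x) <= K * nrm x.
Proof.
move=> /bounded_operatorP[M M0 hM].
elim/poly_ind: p => [|p c [K K0 hK]].
  exists 1 => // x; rewrite -[0]/(0%:P) poly_operatorC scale0r nrm0.
  by rewrite mul1r nrm_ge0.
exists (K * M + `|c|) => [|x]; first by rewrite ltr_wpDr ?mulr_gt0.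
rewrite poly_operatorD poly_operatorM poly_operatorX poly_operatorC.
apply: le_trans (ler_nrmD _ _) _; rewrite nrmZ mulrDl lerD2r.
by apply: le_trans (hK _) _; rewrite -mulrA ler_wpM2l// ltW.
Qed.

(** If M bounds the inverse S of z - T, then |x| = |S (z x - T x)| <= M |T x - z x|. *)
Lemma resolvent_bounded_below z : ~ spectrum T z ->
  exists2 c : R, 0 < c & forall x, c * nrm x <= nrm (T x - z *: x).
Proof.
move=> /contrapT[S [/bounded_operatorP[M M0 hM] hS _]].
exists M^-1 => [|x]; first by rewrite invr_gt0.
by rewrite mulrC ler_pdivrMr// mulrC nrm_distC -{1}[x]hS.
Qed.

(** q(T) is a nonzero scalar times a product of factors T - z over the roots z; each is bounded
    below, and the lower bounds multiply. *)
Lemma cpoly_bounded_below q : q != 0 ->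
  (forall z, root q z -> ~ spectrum T z) ->
  exists2 c : R, 0 < c & forall x, c * nrm x <= nrm (cpoly_operator q x).
Proof.
have [r ->] := closed_field_poly_normal q.
set a := lead_coef q => /[dup] q0.
rewrite scaler_eq0 negb_or => /andP[a0 _] qroot.
have {qroot} hr z : z \in r -> ~ spectrum T z.
  by move=> zr; apply: qroot; rewrite rootZ// root_prod_XsubC.
have [c c0 hc] : exists2 c : R, 0 < c & forall x,
    c * nrm x <= nrm (cpoly_operator (\prod_(z <- r) ('X - z%:P)) x).
  elim: r hr {q0} => [|z r IH] hr.
    by exists 1 => // x; rewrite big_nil cpoly_operatorC scale1r mul1r.
  have [u ur|c c0 hc] := IH; first by apply: hr; rewrite inE ur orbT.
  have [d d0 hd] := resolvent_bounded_below (hr z (mem_head _ _)).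
  exists (d * c) => [|x]; first by rewrite mulr_gt0.
  rewrite big_cons cpoly_operatorM.
  set y := cpoly_operator _ x.
  have -> : cpoly_operator ('X - z%:P) y = T y - z *: y.
    rewrite -polyCN cpoly_operatorD cpoly_operatorC scaleNr.
    by rewrite -['X]mul1r cpoly_operatorMX (cpoly_operatorC 1) scale1r.
  by apply: le_trans (hd y); rewrite -mulrA ler_wpM2l ?hc// ltW.
have na : 0 < complex.Re `|a|.
  by move: a0; rewrite -normr_gt0 ltcE => /andP[_].
exists (complex.Re `|a| * c) => [|x]; first by rewrite mulr_gt0.
rewrite -mul_polyC cpoly_operatorM cpoly_operatorC nrmZc -mulrA.
by rewrite ler_wpM2l ?hc// ltW.
Qed.

End PolyOperator.

(** * Spectrum and numerical range *)

Section SelfAdjoint.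
Variables (R : realType) (H : completeNormedModType R[i]).
Variables (dot : {dot H for (@Num.conj R[i])}) (dotP : norm_from_dot dot).
Local Notation rdot := (rdot dot).

(* For e = d / K ^ 2, with K >= d a bound of P, the map
   x |-> x - e (P x - y) is a contraction. *)
Lemma coercive_inverse (P : {linear H -> H}) (d : R) :
  bounded_operator P -> 0 < d -> (forall x, d * nrm x ^+ 2 <= rdot (P x) x) ->
  exists S : {linear H -> H},
    [/\ bounded_operator S, forall x, S (P x) = x & forall x, P (S x) = x].
Proof.
move=> /bounded_operatorP[K0 K00 hK0] d0 hd.
pose K := K0 + d; have Kpos : 0 < K by rewrite addr_gt0.
have hK x : nrm (P x) <= K * nrm x.
  by apply: le_trans (hK0 x) _; rewrite ler_wpM2r ?nrm_ge0// lerDl ltW.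
have low x : d * nrm x <= nrm (P x).
  have [->|x0] := eqVneq x 0; first by rewrite nrm0 mulr0 nrm_ge0.
  have nx : 0 < nrm x by rewrite lt_def nrm_eq0 x0 nrm_ge0.
  rewrite -(ler_pM2r nx) -mulrA -expr2.
  by apply: le_trans (hd x) _; exact: rdot_le.
have injP x y : P x = P y -> x = y.
  move=> Pxy; apply/eqP; rewrite -subr_eq0 -nrm_eq0 eq_le nrm_ge0 andbT.
  by rewrite -(ler_pM2l d0) mulr0; apply: le_trans (low _) _;
    rewrite linearB Pxy subrr nrm0.
pose r := d / K; have r0 : 0 < r by rewrite divr_gt0.
have r1 : r < 1 by rewrite ltr_pdivrMr// mul1r ltrDr.
pose e := r / K; have e0 : 0 < e by rewrite divr_gt0.
have eK : e * K = r by rewrite divfK ?gt_eqF.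
have dK : d = r * K by rewrite divfK ?gt_eqF.
(* |x - e P x|^2 <= (1 - 2 r^2 + r^2) |x|^2, and q^2 >= 1 - r^2. *)
pose q := 1 - r ^+ 2 / 2.
have q0 : 0 < q by rewrite /q; nra.
have q1 : q < 1 by rewrite /q; nra.
have contr x : nrm (x - e%:C *: P x) <= q * nrm x.
  rewrite -(ler_pXn2r (ltn0Sn 1)) ?nnegrE ?mulr_ge0 ?nrm_ge0 ?(ltW q0)//.
  rewrite -(rdotxx dotP) !(rdotBl, rdotBr, rdotZl, rdotZr) !(rdotxx dotP).
  rewrite (rdotC dot x) exprMn.
  have h1 := hd x.
  have h2 : nrm (P x) ^+ 2 <= K ^+ 2 * nrm x ^+ 2.
    by rewrite -exprMn ler_pXn2r ?nnegrE ?mulr_ge0 ?nrm_ge0 ?(ltW Kpos).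
  have h3 : e * (d * nrm x ^+ 2) <= e * rdot (P x) x by rewrite ler_pM2l.
  have h4 : e * (e * nrm (P x) ^+ 2) <= e * (e * (K ^+ 2 * nrm x ^+ 2)).
    by rewrite !ler_pM2l.
  have E3 : e * (d * nrm x ^+ 2) = r ^+ 2 * nrm x ^+ 2.
    by rewrite dK -eK; ring.
  have E4 : e * (e * (K ^+ 2 * nrm x ^+ 2)) = r ^+ 2 * nrm x ^+ 2.
    by rewrite -eK; ring.
  have : q ^+ 2 >= 1 - r ^+ 2 by rewrite /q; nra.
  have := sqr_ge0 (nrm x) => n0 /(ler_wpM2r n0).
  by move: h3 h4; rewrite E3 E4; lra.
have solve y : exists x, P x = y.
  have [u u0 uS] : exists2 u : nat -> H, u 0%N = 0 &
      forall n, u n.+1 = u n - e%:C *: (P (u n) - y).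
    by exists (fun n => iter n (fun x => x - e%:C *: (P x - y)) 0).
  have uD n : u n.+1 - u n = - (e%:C *: (P (u n) - y)).
    by rewrite uS addrAC subrr add0r.
  have du n : nrm (u n.+1 - u n) <= q ^+ n * nrm (u 1%N).
    elim: n => [|n IH]; first by rewrite expr0 mul1r u0 subr0.
    have -> : u n.+2 - u n.+1 =
        (u n.+1 - u n) - e%:C *: P (u n.+1 - u n).
      rewrite (linearB P) !uD -opprD -scalerDr.
      by rewrite [in RHS]addrC subrKA.
    apply: le_trans (contr _) _; rewrite exprS -mulrA.
    by rewrite ler_wpM2l// ltW.
  have q10 : 0 < 1 - q by rewrite subr_gt0.
  pose C := nrm (u 1%N) / (1 - q).
  have C0 : 0 <= C by rewrite divr_ge0 ?nrm_ge0 ?ltW.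
  have CE : nrm (u 1%N) = C * (1 - q) by rewrite divfK ?gt_eqF.
  have [|m n mn|l hl] := @cauchy_limit _ _ u (fun n => q ^+ n * C).
  - rewrite -[X in _ --> X](mul0r C); apply: cvgM; last exact: cvg_cst.
    by apply: cvg_expr; rewrite gtr0_norm.
  (* This sharper geometric sum is what induction on [n] can prove. *)
  - suff h : nrm (u n - u m) <= (q ^+ m - q ^+ n) * C.
      apply: le_trans h _; rewrite ler_wpM2r// gerBl exprn_ge0//.
      exact: ltW.
    elim: n mn => [|n IH].
      by rewrite leqn0 => /eqP ->; rewrite !subrr nrm0 mul0r.
    rewrite leq_eqVlt => /orP[/eqP <-|/IH h].
      by rewrite !subrr nrm0 mul0r.
    apply: le_trans (ler_nrm_dist (u n) _ _) _.
    by have := du n; rewrite CE exprS; lra.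
  (* |P l - y| <= |P (u_n - l)| + |P u_n - y| with P u_n - y = (u_n - u_{n+1}) / e, so both terms
     are of order q^n. *)
  exists l; apply/eqP; rewrite -subr_eq0 -nrm_eq0 eq_le nrm_ge0 andbT.
  apply/ler_addgt0Pr => a a0; rewrite add0r.
  have qn0 : (fun n => q ^+ n * (C * (K + e^-1))) @ \oo --> (0 : R).
    rewrite -[X in _ --> X](mul0r (C * (K + e^-1))).
    apply: cvgM; last exact: cvg_cst.
    by apply: cvg_expr; rewrite gtr0_norm.
  move/cvgrPdist_lt : qn0 => /(_ a a0)[n _ /(_ n (leqnn n))] /=.
  rewrite sub0r normrN => /(le_lt_trans (ler_norm _))/ltW; apply: le_trans.
  apply: le_trans (ler_nrm_dist (P (u n)) _ _) _.
  rewrite -linearB (mulrDr C) (mulrDr (q ^+ n)) lerD//.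
    apply: le_trans (hK _) _; rewrite nrm_distC mulrA [leRHS]mulrC ler_pM2l//.
  have -> : P (u n) - y = (e^-1)%:C *: (u n - u n.+1).
    rewrite uS opprB [u n + _]addrC subrK scalerA -rmorphM mulVf ?gt_eqF//.
    by rewrite scale1r.
  rewrite nrmZ nrm_distC gtr0_norm ?invr_gt0// [leRHS]mulrA [leRHS]mulrC.
  rewrite ler_pM2l ?invr_gt0//; apply: le_trans (du n) _.
  rewrite CE ler_wpM2l ?exprn_ge0 ?(ltW q0)//.
  by rewrite ler_piMr// lerBlDr lerDl ltW.
(* The inverse is obtained by choice; surjectivity excludes the default 0, and injectivity of P
   makes it linear. *)
have bij x : P (xget 0 [set z | P z = x]) = x.
  exact: (xgetPex 0 (solve x)).
pose S x := xget 0 [set z | P z = x].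
have linS : linear S.
  by move=> a x y; apply: injP; rewrite linearP !bij.
pose SL := GRing.isLinear.Build R[i] H H _ S linS.
pose SLin : {linear H -> H} := HB.pack S SL.
exists SLin; split => [|x|x]; last exact: bij.
  exists (d^-1) => x; rewrite !nrmE -rmorphM lecR mulrC ler_pdivlMr// mulrC.
  by apply: le_trans (low _) _; rewrite bij.
by apply: injP; rewrite bij.
Qed.

(** Expand <Pz,z> >= 0 at z = x - K^-1 P x and bound <PPx,Px> by K |Px|^2. *)
Lemma psd_norm_bound (P : {linear H -> H}) (K : R) :
  (forall x y, rdot (P x) y = rdot x (P y)) ->
  (forall x, 0 <= rdot (P x) x) -> 0 < K ->
  (forall x, nrm (P x) <= K * nrm x) ->
  forall x, nrm (P x) ^+ 2 <= K * rdot (P x) x.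
Proof.
move=> saP psdP K0 hK x.
have := psdP (x - (K^-1)%:C *: P x).
rewrite linearB linearZ /= !(rdotBl, rdotBr, rdotZl, rdotZr).
rewrite (saP (P x) x) !(rdotxx dotP) => h.
have h2 : rdot (P (P x)) (P x) <= K * nrm (P x) ^+ 2.
  apply: le_trans (rdot_le dotP _ _) _.
  by rewrite expr2 mulrA ler_wpM2r ?nrm_ge0.
have : K^-1 * (K^-1 * rdot (P (P x)) (P x)) <= K^-1 * nrm (P x) ^+ 2.
  rewrite ler_pM2l ?invr_gt0// -(ler_pM2l K0) mulrA divff ?gt_eqF// mul1r//.
move=> h3; rewrite -ler_pdivrMl//; move: h h3; set a := K^-1 * nrm _ ^+ 2.
by set b := K^-1 * (K^-1 * _); lra.
Qed.

End SelfAdjoint.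

(** * Bounds for p(T) from the values of p on the spectrum *)

Section SpectralCalculus.
Variables (R : realType) (H : completeNormedModType R[i]).
Variables (dot : {dot H for (@Num.conj R[i])}) (dotP : norm_from_dot dot).
Variables (T : {linear H -> H}).
Hypotheses (bndT : bounded_operator T) (saT : self_adjoint dot T).
Hypothesis realT : forall z, spectrum T z -> exists t : R, z = t%:C.
Local Notation rdot := (rdot dot).
Implicit Types p : {poly R}.

Lemma poly_operator_rdot p x y :
  rdot (poly_operator T p x) y = rdot x (poly_operator T p y).
Proof.
elim/poly_ind: p x y => [|p c IH] x y.
  by rewrite -[0]/(0%:P) !poly_operatorC rdotZl rdotZr !mul0r.
rewrite !poly_operatorD !poly_operatorC [p * 'X]mulrC.
rewrite {1}[_ * p]mulrC !poly_operatorM !poly_operatorX.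
by rewrite rdotDl rdotDr rdotZl rdotZr IH -(self_adjoint_rdot _ _ saT).
Qed.

(** If p misses the value m on the spectrum, q = p - m gives |q(T)x| >= c |x|, while q(T) >= 0 gives
    |q(T)x|^2 <= L <q(T)x,x>, which is arbitrarily small on unit vectors. *)
Lemma spectrum_min_nonconstant (x0 : H) p : x0 != 0 -> (1 < size p)%N ->
  exists2 t : R, spectrum T t%:C &
    forall x, p.[t] * nrm x ^+ 2 <= rdot (poly_operator T p x) x.
Proof.
move=> x00 sp.
have [K K0 hK] := poly_operator_bounded p bndT.
pose W := [set rdot (poly_operator T p x) x | x in [set x : H | nrm x = 1]].
have Wlb : has_lbound W.
  exists (- K) => _ [x /= x1 <-]; rewrite lerNl -rdotNl.
  apply: le_trans (rdot_le dotP _ _) _; rewrite nrmN x1 mulr1.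
  by have := hK x; rewrite x1 mulr1.
have W0 : W !=set0.
  by eexists; exists ((nrm x0)^-1%:C *: x0); first exact: nrm_unit.
pose m := inf W.
have mle x : m * nrm x ^+ 2 <= rdot (poly_operator T p x) x.
  have [->|xn0] := eqVneq x 0.
    by rewrite linear0 (rdotxx dotP) nrm0 expr0n mulr0.
  have nx : 0 < nrm x by rewrite lt_def nrm_eq0 xn0 nrm_ge0.
  rewrite -ler_pdivlMr ?exprn_gt0//; apply: ge_inf => //.
  exists ((nrm x)^-1%:C *: x); first exact: nrm_unit.
  by rewrite linearZ /= rdotZl rdotZr mulrA -expr2 exprVn mulrC.
apply: contrapT => nt.
pose q := p - m%:P.
have q0 : q != 0.
  apply: contraL sp; rewrite subr_eq0 => /eqP ->.
  by rewrite -leqNgt size_polyC_leq1.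
have qE x : rdot (poly_operator T q x) x =
    rdot (poly_operator T p x) x - m * nrm x ^+ 2.
  by rewrite poly_operatorB poly_operatorC rdotBl rdotZl (rdotxx dotP).
have [||c c0 hc] := @cpoly_bounded_below _ _ T (map_poly (real_complex R) q).
- by rewrite map_poly_eq0.
- move=> z rz sz; have [t zt] := realT sz; apply: nt.
  exists t; first by rewrite -zt.
  move: rz; rewrite zt fmorph_root /root /q !hornerE subr_eq0 => /eqP ->.
  exact: mle.
have [L L0 hL] := poly_operator_bounded q bndT.
(* A unit vector within this distance of the infimum has |q(T)x|^2 < c^2 / 2, against |q(T)x| >=
   c. *)
have e0 : 0 < c ^+ 2 / (2 * L) by rewrite divr_gt0 ?exprn_gt0 ?mulr_gt0.
have [_ [x /= x1 <-]] := inf_adherent e0 (conj W0 Wlb).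
have := @psd_norm_bound _ _ _ dotP (poly_operator T q) L
  (@poly_operator_rdot q) _ L0 hL x.
rewrite qE x1 expr1n mulr1 => h1 h2.
have {}h1 : nrm (poly_operator T q x) ^+ 2 <=
    L * (rdot (poly_operator T p x) x - m).
  by apply: h1 => y; rewrite qE subr_ge0.
have h3 : c ^+ 2 <= nrm (poly_operator T q x) ^+ 2.
  rewrite ler_pXn2r ?nnegrE ?nrm_ge0 ?(ltW c0)//.
  by have := hc x; rewrite x1 mulr1 -poly_operatorE.
have : L * (rdot (poly_operator T p x) x - m) < c ^+ 2 / 2.
  rewrite mulrC -ltr_pdivlMr// ltrBlDl.
  by apply: lt_le_trans h2 _; rewrite lerD2l invfM mulrA.
have := exprn_gt0 2 c0; move: h1 h3; lra.
Qed.

(** For constant p any spectral point serves; the case of ['X] supplies one. *)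
Lemma spectrum_min (x0 : H) p : x0 != 0 ->
  exists2 t : R, spectrum T t%:C &
    forall x, p.[t] * nrm x ^+ 2 <= rdot (poly_operator T p x) x.
Proof.
move=> x00; have [|sp] := ltnP 1 (size p).
  exact: spectrum_min_nonconstant x00.
have [|t st _] := @spectrum_min_nonconstant x0 'X x00.
  by rewrite size_polyX.
exists t => // x; rewrite (size1_polyC sp) hornerC poly_operatorC rdotZl.
by rewrite (rdotxx dotP).
Qed.

Lemma poly_operator_le p (c : R) x :
  (forall t : R, spectrum T t%:C -> c <= p.[t]) ->
  c * nrm x ^+ 2 <= rdot (poly_operator T p x) x.
Proof.
move=> hc; have [->|x0] := eqVneq x 0.
  by rewrite linear0 (rdotxx dotP) nrm0 expr0n mulr0.
have [t st ht] := spectrum_min p x0.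
by apply: le_trans (ht x); rewrite ler_wpM2r ?sqr_ge0 ?hc.
Qed.

(** |p(T)x|^2 = <p^2(T)x,x>, and p^2 <= c^2 on the spectrum. *)
Lemma poly_operator_norm p (c : R) x : 0 <= c ->
  (forall t : R, spectrum T t%:C -> `|p.[t]| <= c) ->
  nrm (poly_operator T p x) <= c * nrm x.
Proof.
move=> c0 hc.
rewrite -(ler_pXn2r (ltn0Sn 1)) ?nnegrE ?mulr_ge0 ?nrm_ge0//.
rewrite -(rdotxx dotP) -poly_operator_rdot -poly_operatorM exprMn.
have := @poly_operator_le (- (p * p)) (- c ^+ 2) x.
rewrite poly_operatorN rdotNl mulNr lerN2; apply => t /hc h.
rewrite hornerN hornerM lerN2 -expr2 -real_normK ?num_real//.
by rewrite ler_pXn2r ?nnegrE.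
Qed.

(** The minima for ['X] and [- 'X]. Since the ends are spectral, an interval J containing the
    spectrum contains [a, b]. *)
Lemma spectrum_hull (x0 : H) : x0 != 0 -> exists a b : R,
  [/\ spectrum T a%:C, spectrum T b%:C &
      forall x, a * nrm x ^+ 2 <= rdot (T x) x <= b * nrm x ^+ 2].
Proof.
move=> x00; have [a sa ha] := spectrum_min 'X x00.
have [b sb hb] := spectrum_min (- 'X) x00; exists a, b; split=> // x.
have := ha x; have := hb x; rewrite poly_operatorN !poly_operatorX.
by rewrite hornerN !hornerX rdotNl mulNr lerN2 => -> ->.
Qed.

(** For t < a the operator T - t is coercive, for t > b the operator t - T is; either way t - T has
    a bounded inverse. *)
Lemma spectrum_itv (a b t : R) :
  (forall x, a * nrm x ^+ 2 <= rdot (T x) x <= b * nrm x ^+ 2) ->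
  spectrum T t%:C -> a <= t <= b.
Proof.
move=> ab st; have bnd p : bounded_operator (poly_operator T p).
  have [K _ hK] := poly_operator_bounded p bndT; exists K => x.
  by rewrite !nrmE -rmorphM lecR.
have E x : poly_operator T ('X - t%:P) x = T x - t%:C *: x.
  by rewrite poly_operatorB poly_operatorX poly_operatorC.
have E' x : poly_operator T (t%:P - 'X) x = t%:C *: x - T x.
  by rewrite poly_operatorB poly_operatorX poly_operatorC.
apply/andP; split; rewrite leNgt; apply/negP => h; apply: st.
- have [|x|S [bS S1 S2]] := @coercive_inverse _ _ _ dotP
    (poly_operator T ('X - t%:P)) (a - t) (bnd _).
  + by rewrite subr_gt0.
  + rewrite /= E rdotBl rdotZl (rdotxx dotP) mulrBl lerD2r.
    by have /andP[] := ab x.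
  move: S1 S2 => /= S1 S2.
  (* S inverts T - t, whereas [spectrum] refers to t - T: hence the sign. *)
  have linN : linear (fun x => - S x).
    by move=> z x y; rewrite linearP opprD scalerN.
  pose SL := GRing.isLinear.Build R[i] H H _ (fun x => - S x) linN.
  exists (HB.pack (fun x => - S x) SL : {linear H -> H}); split=> [|x|x] /=.
  + by move: bS => [M hM]; exists M => x; rewrite normrN.
  + by rewrite -[LHS]/(- S _) -(linearN S) opprB -E S1.
  + rewrite -[LHS]/(t%:C *: (- S x) - T (- S x)).
    by rewrite scalerN (linearN T) opprK addrC -E S2.
- have [|x|S [bS S1 S2]] := @coercive_inverse _ _ _ dotP
    (poly_operator T (t%:P - 'X)) (t - b) (bnd _).
  + by rewrite subr_gt0.
  + rewrite /= E' rdotBl rdotZl (rdotxx dotP) mulrBl lerD2l lerN2.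
    by have /andP[] := ab x.
  move: S1 S2 => /= S1 S2.
  exists S; split=> // x; first by rewrite -E' S1.
  by rewrite -E' S2.
Qed.

End SpectralCalculus.

(** * Continuous functional calculus *)

Section ContinuousCalculus.
Variables (R : realType) (H : completeNormedModType R[i]).
Variables (dot : {dot H for (@Num.conj R[i])}) (dotP : norm_from_dot dot).
Variables (T : {linear H -> H}).
Hypotheses (bndT : bounded_operator T) (saT : self_adjoint dot T).
Hypothesis realT : forall z, spectrum T z -> exists t : R, z = t%:C.
Local Notation rdot := (rdot dot).

(** Existence of g(T), so that [cfc] is not its default: Weierstrass polynomials on [a, b], which
    contains the spectrum, give a Cauchy sequence in operator norm. *)
Lemma is_cfc_cfc (a b : R) (g : R -> R) :
  (forall x, a * nrm x ^+ 2 <= rdot (T x) x <= b * nrm x ^+ 2) ->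
  {within `[a, b], continuous g} -> is_cfc T g (cfc T g).
Proof.
move=> ab gc; apply: (@xgetPex _ (fun=> 0) [set S | is_cfc T g S]).
have inv0 n : 0 < (n.+1%:R)^-1 :> R by rewrite invr_gt0.
have [p hp] := choice (fun n => weierstrass gc (inv0 n)).
have hspec n (t : R) : spectrum T t%:C -> `|(p n).[t] - g t| <= n.+1%:R^-1.
  by move=> /(spectrum_itv dotP bndT ab) abt; apply: hp; rewrite in_itv.
have small (r : R) : 0 < r -> exists N, forall n, (N <= n)%N -> n.+1%:R^-1 <= r.
  move=> r0; exists (Num.truncn r^-1) => n Nn; rewrite invf_ple ?posrE//.
  apply: le_trans (ltW (truncnS_gt _)) _.
  by rewrite ler_nat ltnS.
(* The limit is taken pointwise, but the rate is proportional to |x|, hence uniform in operator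
   norm. *)
have lim x : exists l, forall n,
    nrm (poly_operator T (p n) x - l) <= 2 * n.+1%:R^-1 * nrm x.
  apply: (@cauchy_limit _ _ _ (fun n => 2 * n.+1%:R^-1 * nrm x)).
    rewrite -[X in _ --> X](mul0r (nrm x)); apply: cvgM; last exact: cvg_cst.
    rewrite -[X in _ --> X](mulr0 2); apply: cvgM; first exact: cvg_cst.
    exact: cvg_harmonic.
  move=> m n mn; rewrite -poly_operatorB.
  apply: (poly_operator_norm dotP bndT saT realT).
    by rewrite mulr_ge0.
  move=> t st; rewrite hornerD hornerN.
  have := hspec n _ st; have := hspec m _ st.
  have : n.+1%:R^-1 <= m.+1%:R^-1 :> R by rewrite lef_pV2 ?posrE// ler_nat ltnS.
  have := ler_distD (g t) (p n).[t] (p m).[t].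
  rewrite [`|g t - _|]distrC.
  by move: (n.+1%:R^-1) (m.+1%:R^-1) => a1 a2; lra.
have [S hS] := choice lim; exists S, p; split=> e e0.
  have [N hN] := small e e0; exists N => // n /= Nn t st.
  by apply: le_trans (hspec n t st) (hN n Nn).
have [N hN] := small (e / 2) (divr_gt0 e0 (ltr0n _ 2)).
exists N => // n /= Nn x; rewrite !nrmE -rmorphM lecR.
apply: le_trans (hS x n) _; rewrite ler_wpM2r ?nrm_ge0//.
by have := hN n Nn; move: (n.+1%:R^-1) => a1; lra.
Qed.

Variables (g : R -> R) (S : H -> H).
Hypothesis gS : is_cfc T g S.

Lemma is_cfc_poly (e : R) : 0 < e -> exists p : {poly R},
  (forall t : R, spectrum T t%:C -> `|p.[t] - g t| <= e) /\
  (forall x, nrm (poly_operator T p x - S x) <= e * nrm x).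
Proof.
move=> e0; case: gS => p [/(_ e e0)[N _ hN] /(_ e e0)[M _ hM]].
exists (p (maxn N M)); split; first exact: (hN _ (leq_maxl _ _)).
move=> x; apply: le_trans (_ : complex.Re (e%:C * `|x|) <= _).
  by have := hM _ (leq_maxr N M) x; rewrite lecE => /andP[].
by rewrite ReZ.
Qed.

Lemma cfc_bounded : exists2 K : R, 0 < K & forall x, nrm (S x) <= K * nrm x.
Proof.
have [p [_ hp]] := is_cfc_poly ltr01.
have [K K0 hK] := poly_operator_bounded p bndT.
exists (1 + K) => [|x]; first by rewrite addr_gt0.
rewrite -[S x](subrK (poly_operator T p x)) mulrDl.
by apply: le_trans (ler_nrmD _ _) _; rewrite lerD// nrm_distC hp.
Qed.

(** [S] is a bare function, so homogeneity is inherited from its polynomial approximations. It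
    serves to reduce quadratic forms to unit vectors. *)
Lemma cfcZ (c : R) x : S (c%:C *: x) = c%:C *: S x.
Proof.
apply/eqP; rewrite -subr_eq0 -nrm_eq0 eq_le nrm_ge0 andbT.
apply/ler_addgt0Pr => e e0; rewrite add0r.
pose M := 2 * `|c| * nrm x + 1.
have M0 : 0 < M by rewrite ltr_wpDl ?mulr_ge0 ?nrm_ge0.
have [p [_ hp]] := is_cfc_poly (divr_gt0 e0 M0).
apply: le_trans (ler_nrm_dist (poly_operator T p (c%:C *: x)) _ _) _.
have h1 := hp (c%:C *: x); have h2 := hp x.
rewrite nrm_distC [X in _ + nrm (X - _)]linearZ /= -scalerBr !nrmZ.
rewrite nrmZ in h1.
have {}h2 := ler_wpM2l (normr_ge0 c) h2.
apply: le_trans (lerD h1 h2) _.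
have -> : e / M * (`|c| * nrm x) + `|c| * (e / M * nrm x) = e / M * (M - 1).
  by rewrite /M; ring.
by rewrite mulrBr divfK ?gt_eqF// mulr1 gerBl divr_ge0 ?ltW.
Qed.

(** Symmetry for the pair ix, x reads - Im z = Im z, where z = <p(T)x,x>. *)
Lemma poly_operator_Im p x : complex.Im (dot (poly_operator T p x) x) = 0.
Proof.
have : rdot (poly_operator T p ('i%C *: x)) x =
    rdot ('i%C *: x) (poly_operator T p x).
  exact: poly_operator_rdot.
rewrite linearZ /= /rdot !linearZl_LR /= (dot_conj dot x).
by case: (dot _ _) => a b /=; lra.
Qed.

(** Positivity in R[i] includes being real; this passes to the limit from polynomials. *)
Lemma cfc_Im x : complex.Im (dot (S x) x) = 0.
Proof.
apply/eqP; rewrite -normr_eq0 eq_le normr_ge0 andbT.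
apply/ler_addgt0Pr => e e0; rewrite add0r.
have M0 : 0 < nrm x ^+ 2 + 1 by rewrite ltr_wpDl ?sqr_ge0.
have [p [_ hp]] := is_cfc_poly (divr_gt0 e0 M0).
have := Im_dot_norm dotP (poly_operator T p x - S x) x.
have ImB (z w : R[i]) : complex.Im (z - w) = complex.Im z - complex.Im w.
  by case: z; case: w.
rewrite linearBl ImB poly_operator_Im sub0r normrN => h.
apply: le_trans h _; apply: le_trans (ler_wpM2r (nrm_ge0 x) (hp x)) _.
rewrite -mulrA -expr2 mulrAC ler_pdivrMr// ler_wpM2l ?ltW//.
by rewrite ltrDl.
Qed.

End ContinuousCalculus.

(** * From scalar inequalities on the spectrum to quadratic forms *)

Section OperatorInequalities.
Variables (R : realType) (H : completeNormedModType R[i]).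
Variables (dot : {dot H for (@Num.conj R[i])}) (dotP : norm_from_dot dot).
Variables (T : {linear H -> H}).
Hypotheses (bndT : bounded_operator T) (saT : self_adjoint dot T).
Hypothesis realT : forall z, spectrum T z -> exists t : R, z = t%:C.
Local Notation rdot := (rdot dot).

(* (a1, a2) = (1, 1) serves for tangents of g1 with slope g2, (-1, 0) for
   Jensen's inequality, (0, 1) for a Chebyshev-type correlation inequality and
   (1, 0) for plain upper bounds. *)
Lemma cfc_quadratic_le (g1 g2 : R -> R) (S1 S2 : H -> H) (a1 a2 s c0 c1 : R) :
  is_cfc T g1 S1 -> is_cfc T g2 S2 ->
  (forall t : R, spectrum T t%:C ->
     a1 * g1 t + a2 * (g2 t * (s - t)) <= c0 + c1 * t) ->
  forall x, a1 * rdot (S1 x) x +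
            a2 * (s * rdot (S2 x) x - rdot (S2 (T x)) x) <=
            c0 * nrm x ^+ 2 + c1 * rdot (T x) x.
Proof.
move=> cfc1 cfc2 hg x.
have [K K0 hK] := bounded_operatorP bndT.
have specK (t : R) : spectrum T t%:C -> `|t| <= K.
  rewrite ler_norml; apply: (spectrum_itv dotP bndT) => y.
  have : `|rdot (T y) y| <= K * nrm y ^+ 2.
    apply: le_trans (rdot_norm dotP _ _) _.
    by rewrite expr2 mulrA ler_wpM2r ?nrm_ge0.
  by rewrite ler_norml mulNr.
pose N := nrm x ^+ 2; have N0 : 0 <= N by exact: sqr_ge0.
(* Replacing g1, g2 by polynomials within e costs at most e L on the spectrum and e L |x|^2 in the
   quadratic forms; [e] below makes the total 2 e L |x|^2 at most d. *)
pose L := `|a1| + `|a2| * (`|s| + K).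
have L0 : 0 <= L by rewrite addr_ge0// mulr_ge0// addr_ge0// ltW.
apply/ler_addgt0Pr => d d0.
have M0 : 0 < 2 * L * N + 1 :=
  ltr_wpDl (mulr_ge0 (mulr_ge0 (ler0n _ 2) L0) N0) ltr01.
pose e := d / (2 * L * N + 1); have e0 : 0 < e by rewrite divr_gt0.
have [p1 [hp1 S1p]] := is_cfc_poly cfc1 e0.
have [p2 [hp2 S2p]] := is_cfc_poly cfc2 e0.
(* Right side minus left side of the scalar inequality, with p1, p2 for g1, g2. *)
pose r := c0%:P + c1%:P * 'X - a1%:P * p1 - a2%:P * (s%:P * p2 - p2 * 'X).
have rx : rdot (poly_operator T r x) x = c0 * N + c1 * rdot (T x) x -
    a1 * rdot (poly_operator T p1 x) x -
    a2 * (s * rdot (poly_operator T p2 x) x -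
          rdot (poly_operator T p2 (T x)) x).
  rewrite /r !(poly_operatorB, poly_operatorD, poly_operatorM, poly_operatorC).
  rewrite !poly_operatorX.
  by rewrite !(rdotBl, rdotDl, rdotNl, rdotZl) (rdotxx dotP).
have rlow : - (e * L) * N <= rdot (poly_operator T r x) x.
  apply: (poly_operator_le dotP bndT saT realT) => t st.
  rewrite /r !(hornerD, hornerN, hornerM, hornerC, hornerX).
  have h1 : a1 * (p1.[t] - g1 t) <= `|a1| * e.
    apply: le_trans (ler_norm _) _; rewrite normrM ler_wpM2l//.
    exact: hp1.
  have h2 : a2 * ((p2.[t] - g2 t) * (s - t)) <= `|a2| * (e * (`|s| + K)).
    apply: le_trans (ler_norm _) _; rewrite !normrM ler_wpM2l//.
    rewrite ler_pM//; first exact: hp2.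
    by apply: le_trans (ler_normB _ _) _; rewrite lerD2l specK.
  by have := hg t st; rewrite /L; lra.
have dist1 (S : H -> H) p y :
    (forall z, nrm (poly_operator T p z - S z) <= e * nrm z) ->
    `|rdot (S y) x - rdot (poly_operator T p y) x| <= e * nrm y * nrm x.
  move=> hS; rewrite -rdotBl; apply: le_trans (rdot_norm dotP _ _) _.
  by rewrite ler_wpM2r ?nrm_ge0// nrm_distC hS.
have k1 : a1 * (rdot (S1 x) x - rdot (poly_operator T p1 x) x) <=
    `|a1| * (e * N).
  apply: le_trans (ler_norm _) _; rewrite normrM ler_wpM2l//.
  by apply: le_trans (dist1 _ _ x S1p) _; rewrite -mulrA -expr2.
have k2 : a2 * (s * (rdot (S2 x) x - rdot (poly_operator T p2 x) x) -
      (rdot (S2 (T x)) x - rdot (poly_operator T p2 (T x)) x)) <=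
    `|a2| * (e * N * (`|s| + K)).
  apply: le_trans (ler_norm _) _; rewrite normrM ler_wpM2l//.
  apply: le_trans (ler_normB _ _) _; rewrite normrM mulrDr lerD//.
    rewrite mulrC ler_wpM2r//.
    by apply: le_trans (dist1 _ _ x S2p) _; rewrite -mulrA -expr2.
  apply: le_trans (dist1 _ _ _ S2p) _.
  have -> : e * N * K = e * (K * nrm x) * nrm x by rewrite /N; ring.
  by rewrite ler_wpM2r ?nrm_ge0// ler_wpM2l// ltW.
have : e * (2 * L * N) <= d.
  by rewrite /e mulrAC ler_pdivrMr// ler_wpM2l ?lerDl// ltW.
move: rlow; rewrite rx; move: k1 k2; rewrite /L -/N.
by lra.
Qed.

End OperatorInequalities.

(** * Sign of gamma and the operator inequality *)

Theorem corollary2p6 (R : realType) (H : completeNormedModType R[i])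
    (dot : {dot H for (@Num.conj R[i])}) (dotP : norm_from_dot dot)
    (J : set R) (itvJ : is_interval J)
    (A B : {linear H -> H})
    (bndA : bounded_operator A) (bndB : bounded_operator B)
    (saA : self_adjoint dot A) (saB : self_adjoint dot B)
    (spA : spectrum A `<=` (fun t : R => t%:C) @` J)
    (spB : spectrum B `<=` (fun t : R => t%:C) @` J)
    (f : R -> R) (fC1 : C1co J f)
    (leBA : operator_le dot B A)
    (f_decr : forall t : R, J t -> derive_in J f t <= 0) :
  let f'B : H -> H := cfc B (derive_in J f) in
  let values : set R :=
    [set complex.Re (dot (f'B (B x)) x - dot (A x) x * dot (f'B x) x)
      | x in [set x : H | `|x| = 1]] in
  let gamma : R := sup values in
  [/\ has_ubound values,
      0 <= gamma
    & operator_le dot (cfc B f) (fun x => cfc A f x + gamma%:C *: x)].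
Proof.
move=> f'B values gamma.
(* In the zero space there is no unit vector, and [sup] of the empty set is 0 by default. *)
have [[x0 x00]|triv] := pselect (exists x : H, x != 0); last first.
  have H0 (x : H) : x = 0.
    by apply/eqP/negPn/negP => xn0; apply: triv; exists x.
  have values0 : values = set0.
    apply/seteqP; split=> // r [x /= + _].
    by rewrite (H0 x) normr0 => /eqP; rewrite eq_sym oner_eq0.
  split; first by rewrite values0; exists 0.
    by rewrite /gamma values0 sup0.
  by move=> x; rewrite (H0 x) linear0r.
have realA z : spectrum A z -> exists t : R, z = t%:C.
  by move=> /spA[t _ <-]; exists t.
have realB z : spectrum B z -> exists t : R, z = t%:C.
  by move=> /spB[t _ <-]; exists t.
have JA (t : R) : spectrum A t%:C -> J t by move=> /spA[r Jr /(@complexI R) <-].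
have JB (t : R) : spectrum B t%:C -> J t by move=> /spB[r Jr /(@complexI R) <-].
have [a [b [/JA Ja /JA Jb hA]]] := spectrum_hull dotP bndA saA realA x00.
have [c [d [/JB Jc /JB Jd hB]]] := spectrum_hull dotP bndB saB realB x00.
have Jab t : a <= t <= b -> J t by exact: itvJ.
have Jcd t : c <= t <= d -> J t by exact: itvJ.
have cA : is_cfc A f (cfc A f).
  apply: (is_cfc_cfc dotP bndA saA realA hA).
  apply: (C1co_continuous fC1) => t; rewrite /= in_itv; exact: Jab.
have cB : is_cfc B f (cfc B f).
  apply: (is_cfc_cfc dotP bndB saB realB hB).
  apply: (C1co_continuous fC1) => t; rewrite /= in_itv; exact: Jcd.
have cB' : is_cfc B (derive_in J f) f'B.
  apply: (is_cfc_cfc dotP bndB saB realB hB).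
  apply: (derive_in_continuous itvJ fC1) => t; rewrite /= in_itv; exact: Jcd.
pose V x := rdot dot (f'B (B x)) x - rdot dot (A x) x * rdot dot (f'B x) x.
(* <Ax,x> is real, so the real part of the product is the product of the real parts. *)
have VE x : complex.Re (dot (f'B (B x)) x - dot (A x) x * dot (f'B x) x) = V x.
  rewrite /V /rdot; have := self_adjoint_Im x saA.
  case: (dot (A x) x) (dot (f'B x) x) (dot (f'B (B x)) x).
  move=> ? ? [? ?] [? ?] /= ->.
  by rewrite mul0r subr0.
have unitE (x : H) : `|x| = 1 -> nrm x = 1 by rewrite /nrm => ->.
have Eunit (x : H) : nrm x = 1 -> `|x| = 1 by rewrite nrmE => ->.
have uval : has_ubound values.
  have [K K0 hK] := cfc_bounded bndB cB'.
  have [KA KA0 hKA] := bounded_operatorP bndA.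
  have [KB KB0 hKB] := bounded_operatorP bndB.
  exists (K * KB + KA * K) => _ [x /= /unitE x1 <-]; rewrite VE /V.
  have h1 : rdot dot (f'B (B x)) x <= K * KB.
    apply: le_trans (rdot_le dotP _ _) _; rewrite x1 mulr1.
    apply: le_trans (hK _) _; rewrite ler_pM2l//.
    by have := hKB x; rewrite x1 mulr1.
  have h2 : - (rdot dot (A x) x * rdot dot (f'B x) x) <= KA * K.
    apply: le_trans (ler_norm _) _; rewrite normrN normrM ler_pM//.
      apply: le_trans (rdot_norm dotP _ _) _; rewrite x1 mulr1.
      by have := hKA x; rewrite x1 mulr1.
    apply: le_trans (rdot_norm dotP _ _) _; rewrite x1 mulr1.
    by have := hK x; rewrite x1 mulr1.
  by lra.
have Vle x : nrm x = 1 -> V x <= gamma.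
  move=> x1; apply: ub_le_sup => //; exists x; last exact: VE.
  exact: Eunit.
have JAx x : nrm x = 1 -> J (rdot dot (A x) x).
  by move=> x1; apply: Jab; have := hA x; rewrite x1 expr1n !mulr1.
have JBx x : nrm x = 1 -> J (rdot dot (B x) x).
  by move=> x1; apply: Jcd; have := hB x; rewrite x1 expr1n !mulr1.
split=> //.
  (* It suffices that V is non-negative at one unit vector. *)
  pose x := (nrm x0)^-1%:C *: x0; have x1 : nrm x = 1 by exact: nrm_unit.
  apply: le_trans (Vle x x1).
  pose m := rdot dot (B x) x; pose D := derive_in J f m.
  have ms : m <= rdot dot (A x) x.
    by rewrite -subr_ge0 -rdotBl; have := leBA x; rewrite lecE => /andP[_].
  have neg : rdot dot (f'B x) x <= 0.
    have := cfc_quadratic_le dotP bndB saB realB (a1 := 1) (a2 := 0) (s := 0)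
      (c0 := 0) (c1 := 0) cB' cB' _ x.
    rewrite !mul0r !addr0 mul1r; apply=> t /JB /f_decr.
    by rewrite !mul0r !addr0 mul1r.
  (* On the spectrum f'(t)(m - t) <= D (m - t), and the right side averages to 0 because <Bx,x> =
     m. *)
  have cov : m * rdot dot (f'B x) x - rdot dot (f'B (B x)) x <= 0.
    have := cfc_quadratic_le dotP bndB saB realB (a1 := 0) (a2 := 1) (s := m)
      (c0 := D * m) (c1 := - D) cB' cB' _ x.
    rewrite x1 expr1n mulr1 mul0r add0r mul1r mulNr subrr; apply=> t /JB Jt.
    have := derive_in_mono itvJ fC1 Jt (JBx x x1); rewrite -/m -/D.
    by rewrite mul0r add0r mul1r; lra.
  (* V x >= (m - <Ax,x>) <f'(B)x,x>, a product of two non-positive numbers. *)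
  rewrite /V; nra.
have unit_ge0 x : nrm x = 1 ->
    rdot dot (cfc B f x) x <= rdot dot (cfc A f x) x + gamma.
  move=> x1; pose s := rdot dot (A x) x; pose D := derive_in J f s.
  have Js : J s by exact: JAx.
  have tangent : rdot dot (cfc B f x) x +
      (s * rdot dot (f'B x) x - rdot dot (f'B (B x)) x) <= f s.
    have := cfc_quadratic_le dotP bndB saB realB (a1 := 1) (a2 := 1) (s := s)
      (c0 := f s) (c1 := 0) cB cB' _ x.
    rewrite x1 expr1n mul0r addr0 mulr1 !mul1r; apply=> t /JB Jt.
    by rewrite mul0r addr0 !mul1r; exact: tangent_le.
  (* The tangent at s, negated: - f(t) <= D s - f(s) - D t, whose linear part cancels because <Ax,x>
     = s. *)
  have jensen : f s <= rdot dot (cfc A f x) x.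
    have := cfc_quadratic_le dotP bndA saA realA (a1 := -1) (a2 := 0) (s := 0)
      (c0 := D * s - f s) (c1 := - D) cA cA _ x.
    rewrite x1 expr1n mulr1 mul0r addr0 mulN1r -/s mulNr addrAC subrr add0r.
    rewrite lerN2.
    apply=> t /JA Jt; have := tangent_le itvJ fC1 Jt Js; rewrite -/D.
    by rewrite mul0r addr0 mulN1r; lra.
  by have := Vle x x1; rewrite /V -/s; lra.
(* The order of R[i] asks for a zero imaginary part and a non-negative real part. *)
move=> x; rewrite lecE; apply/andP; split.
  have := cfc_Im dotP saA cA x.
  have := cfc_Im dotP saB cB x.
  rewrite linearBl linearDl linearZl_LR /= -(dotP x) nrmE -rmorphXn.
  case: (dot (cfc A f x) x) (dot (cfc B f x) x) => [r i] [r' i'] /= -> ->.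
  by rewrite mul0r mulr0 !addr0 subr0.
rewrite -[leRHS]/(rdot dot _ x) rdotBl rdotDl rdotZl (rdotxx dotP) subr_ge0.
have [->|xn0] := eqVneq x 0.
  have r0 y : rdot dot y 0 = 0 by rewrite /rdot linear0r.
  by rewrite !r0 nrm0 expr0n mulr0 addr0.
(* Both sides scale by |x|^2, so the unit vector [u] decides. *)
pose u := (nrm x)^-1%:C *: x; have u1 : nrm u = 1 by exact: nrm_unit.
have -> : x = (nrm x)%:C *: u.
  by rewrite /u scalerA -rmorphM divff ?nrm_eq0// scale1r.
clearbody u; move: (nrm x) => n {xn0}.
rewrite (cfcZ cA) (cfcZ cB) !(rdotZl, rdotZr) nrmZ u1 mulr1.
rewrite real_normK ?num_real//.
by have := ler_wpM2l (sqr_ge0 n) (unit_ge0 u u1); lra.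
Qed.
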